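(* Let $\lambda\in[-1,1]$ and $I=[0,1]\times[0,1]$. For each $f\in C(I)$, the bivariate $\lambda$-Bernstein operators $\bar B_{n,m}(f;x,y;\lambda)$ converge to $f(x,y)$ uniformly on $I$ as $n,m\to\infty$.
   Context: $C(I)$ is the space of real continuous functions on $I$. For $n\ge 2$, $0\le i\le n$, $x\in[0,1]$ let $b_{n,i}(x)=\binom{n}{i}x^i(1-x)^{n-i}$. For $\lambda\in[-1,1]$ define $\tilde b_{n,0}(\lambda;x)=b_{n,0}(x)-\frac{\lambda}{n+1}b_{n+1,1}(x)$, $\tilde b_{n,i}(\lambda;x)=b_{n,i}(x)+\lambda\left(\frac{n-2i+1}{n^2-1}b_{n+1,i}(x)-\frac{n-2i-1}{n^2-1}b_{n+1,i+1}(x)\right)$ for $1\le i\le n-1$, $\tilde b_{n,n}(\lambda;x)=b_{n,n}(x)-\frac{\lambda}{n+1}b_{n+1,n}(x)$. For $n,m\ge2$ and $f\in C(I)$ the bivariate $\lambda$-Bernstein operators are $$\bar B_{n,m}(f;x,y;\lambda)=\sum_{k_1=0}^{n}\sum_{k_2=0}^{m} f\left(\frac{k_1}{n},\frac{k_2}{m}\right)\tilde b_{n,k_1}(\lambda;x)\,\tilde b_{m,k_2}(\lambda;y),\qquad (x,y)\in I.$$ *)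

(* Defs.v *)
From HB Require Import structures.
From mathcomp Require Import all_boot all_order all_algebra.
From mathcomp Require Import all_classical all_reals all_analysis.
Set Implicit Arguments.
Unset Strict Implicit.
Unset Printing Implicit Defensive.
Import Order.TTheory GRing.Theory Num.Theory.
Import numFieldNormedType.Exports.
Local Open Scope classical_set_scope.
Local Open Scope ring_scope.

Definition unit_square (R : realType) : set (R * R) := `[0, 1] `*` `[0, 1].

Definition bernstein_basis (R : realType) (n i : nat) (x : R) : R :=
  'C(n, i)%:R * x ^+ i * (1 - x) ^+ (n - i).

(* Meant for 2 <= n and i <= n; in particular n ^ 2 - 1 is then nonzero. *)
Definition lambda_bernstein_basis (R : realType) (lambda : R) (n i : nat)
    (x : R) : R :=
  if i == 0%N then
    bernstein_basis n 0 x - lambda / (n%:R + 1) * bernstein_basis n.+1 1 x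
  else if i == n then
    bernstein_basis n n x - lambda / (n%:R + 1) * bernstein_basis n.+1 n x
  else
    bernstein_basis n i x
    + lambda *
      ((n%:R - 2 * i%:R + 1) / (n%:R ^+ 2 - 1) * bernstein_basis n.+1 i x
       - (n%:R - 2 * i%:R - 1) / (n%:R ^+ 2 - 1)
         * bernstein_basis n.+1 i.+1 x).

(* f is only evaluated on the unit square. *)
Definition lambda_bernstein_op (R : realType) (lambda : R) (n m : nat)
    (f : R * R -> R) (p : R * R) : R :=
  \sum_(k1 < n.+1) \sum_(k2 < m.+1)
    f (k1%:R / n%:R, k2%:R / m%:R)
    * lambda_bernstein_basis lambda n k1 p.1
    * lambda_bernstein_basis lambda m k2 p.2.

(* Main.v *)
(* The lambda-basis is an l^1-small perturbation of the classical Bernstein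
   basis: on [0, 1] the coefficients of its correction terms are bounded by
   1 / (n + 1) and the degree n + 1 basis sums to 1, so the two bases are at
   l^1-distance at most 2 / (n + 1).  For bounded f the lambda-operator is
   therefore within O(1/n + 1/m) of the tensor-product Bernstein operator, and
   the latter converges by Chebyshev's argument: with M a bound of |f| and d a
   modulus of uniform continuity for e,
     |f q - f p| <= e + (2 M / d^2) |q - p|^2,
   whose average over the nodes is at most e + (2 M / d^2) (1/n + 1/m). *)
Require Import Defs.
From HB Require Import structures.
From mathcomp Require Import all_boot all_order all_algebra.
From mathcomp Require Import all_classical all_reals all_analysis.
From mathcomp Require Import ring lra.
Set Implicit Arguments.
Unset Strict Implicit.
Unset Printing Implicit Defensive.
Import Order.TTheory GRing.Theory Num.Theory.
Import numFieldNormedType.Exports.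
Local Open Scope classical_set_scope.
Local Open Scope ring_scope.

(** * Classical Bernstein basis: recursion, partition of unity, second moment *)

Lemma bernstein_basis_ge0 (R : realType) (n i : nat) (x : R) :
  0 <= x <= 1 -> 0 <= bernstein_basis n i x.
Proof.
by case/andP=> x0 x1; rewrite !mulr_ge0 ?exprn_ge0 ?subr_ge0.
Qed.

Lemma bernstein_basisS (R : realType) (n i : nat) (x : R) :
  bernstein_basis n.+1 i.+1 x =
  x * bernstein_basis n i x + (1 - x) * bernstein_basis n i.+1 x.
Proof.
rewrite /bernstein_basis binS natrD subSS exprS.
(* For [n <= i] the truncated exponent [n - i.+1] is wrong, but its binomial factor ['C(n, i.+1)]
   vanishes. *)
have [lt_in|le_ni] := ltnP i n; last by rewrite bin_small//; ring.
by rewrite -(subnSK lt_in) exprS; ring.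
Qed.

(** Conditioning on the last trial: a binomial count of n + 1 trials is one of n trials plus an
    independent Bernoulli variable of mean x. Moments then follow by induction on n. *)
Lemma bernstein_sumS (R : realType) (n : nat) (x : R) (g : nat -> R) :
  \sum_(k < n.+2) g k * bernstein_basis n.+1 k x =
  x * (\sum_(k < n.+1) g k.+1 * bernstein_basis n k x)
  + (1 - x) * (\sum_(k < n.+1) g k * bernstein_basis n k x).
Proof.
rewrite big_ord_recl/=; under eq_bigr do rewrite bernstein_basisS mulrDr.
rewrite big_split/= addrCA; congr (_ + _).
  by rewrite mulr_sumr; apply: eq_bigr => i _; ring.
rewrite big_ord_recr/= [X in _ + (_ + X)](_ : _ = 0); last first.
  by rewrite /bernstein_basis bin_small//; ring.
rewrite addr0 [in RHS]big_ord_recl/= mulrDr mulr_sumr; congr (_ + _).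
  by rewrite /bernstein_basis !bin0 !subn0 exprS; ring.
by apply: eq_bigr => i _; rewrite /bump/= add1n; ring.
Qed.

Lemma bernstein_sum1 (R : realType) (n : nat) (x : R) :
  \sum_(k < n.+1) bernstein_basis n k x = 1.
Proof.
elim: n => [|n IHn].
  by rewrite big_ord1 /bernstein_basis bin0 !expr0 !mulr1.
have E m : \sum_(k < m.+1) 1 * bernstein_basis m k x =
    \sum_(k < m.+1) bernstein_basis m k x.
  by apply: eq_bigr => k _; rewrite mul1r.
by rewrite -E (bernstein_sumS n x (fun=> 1)) !E IHn; ring.
Qed.

(* The free centre [c] is what makes the recursion on [n] close up. *)
Lemma bernstein_second_moment (R : realType) (n : nat) (x c : R) :
  \sum_(k < n.+1) (k%:R - c) ^+ 2 * bernstein_basis n k x =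
  n%:R * x * (1 - x) + (n%:R * x - c) ^+ 2.
Proof.
elim: n c => [|n IHn] c.
  by rewrite big_ord1 /= /bernstein_basis bin0 !expr0; ring.
rewrite (bernstein_sumS n x (fun k => (k%:R - c) ^+ 2)) IHn.
have shift k : k.+1%:R - c = k%:R - (c - 1) by rewrite -(natr1 k); ring.
under eq_bigr do rewrite shift.
by rewrite IHn -natr1; ring.
Qed.

Lemma bernstein_variance_le (R : realType) (n : nat) (x : R) :
  (0 < n)%N -> 0 <= x <= 1 ->
  \sum_(k < n.+1) (k%:R / n%:R - x) ^+ 2 * bernstein_basis n k x <= n%:R^-1.
Proof.
move=> n0 /andP[x0 x1].
have nR : n%:R != 0 :> R by rewrite pnatr_eq0 -lt0n.
have scale (k : nat) :
    (k%:R / n%:R - x) ^+ 2 = n%:R ^- 2 * (k%:R - n%:R * x) ^+ 2.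
  by field.
under eq_bigr do rewrite scale -mulrA.
(* Centring at the mean n x kills the square, leaving the variance x (1 - x) / n, where x (1 - x) is
   at most 1. *)
rewrite -mulr_sumr bernstein_second_moment subrr expr0n addr0.
rewrite (_ : _ * _ = n%:R^-1 * (x * (1 - x))); last by field.
by rewrite ler_piMr ?invr_ge0//; nra.
Qed.

(** * The lambda-basis as a perturbation of the classical basis *)

Lemma lambda_bernstein_basis_dist (R : realType) (lambda : R) (n i : nat)
    (x : R) :
  -1 <= lambda <= 1 -> (2 <= n)%N -> (i <= n)%N -> 0 <= x <= 1 ->
  `|lambda_bernstein_basis lambda n i x - bernstein_basis n i x| <=
  (n%:R + 1)^-1 * (bernstein_basis n.+1 i x + bernstein_basis n.+1 i.+1 x).
Proof.
move=> lam1 n2 le_in x01; rewrite /lambda_bernstein_basis.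
have lam : `|lambda| <= 1 by rewrite ler_norml.
have n2R : 2 <= n%:R :> R by rewrite ler_nat.
have c0 : 0 <= (n%:R + 1)^-1 :> R by rewrite invr_ge0; lra.
have edge b : 0 <= b ->
    `|- (lambda / (n%:R + 1) * b)| <= (n%:R + 1)^-1 * b :> R.
  move=> b0; rewrite normrN !normrM (ger0_norm b0) (ger0_norm c0) -mulrA.
  by rewrite ler_piMl// mulr_ge0.
have B k := bernstein_basis_ge0 n.+1 k x01.
(* Each end index has a single correction term; the other term of the bound is nonnegative and is
   added for uniformity in i. *)
have [->|i0] := eqVneq i 0%N.
  rewrite addrC addrA addNr add0r; apply: le_trans (edge _ (B _)) _.
  by rewrite ler_wpM2l// lerDr.
have [->|i_n] := eqVneq i n.
  rewrite addrC addrA addNr add0r; apply: le_trans (edge _ (B _)) _.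
  by rewrite ler_wpM2l// lerDl.
rewrite addrC addrA addNr add0r normrM.
have i1R : 1 <= i%:R :> R by rewrite ler1n lt0n.
have inR : i%:R + 1 <= n%:R :> R.
  by rewrite natr1 ler_nat ltn_neqAle i_n.
(* As n^2 - 1 = (n - 1)(n + 1), it suffices that n - 2i + 1 and n - 2i - 1 have modulus at most n -
   1, which holds for 1 <= i <= n - 1. *)
have inner d : `|d| <= n%:R - 1 -> `|d / (n%:R ^+ 2 - 1)| <= (n%:R + 1)^-1 :> R.
  move=> hd; rewrite normrM normfV [`|_ ^+ 2 - 1|]ger0_norm; last by nra.
  rewrite ler_pdivrMr; last by nra.
  by rewrite (_ : _^-1 * _ = n%:R - 1)//; field; lra.
apply: le_trans (ler_piMl (normr_ge0 _) lam) _.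
apply: le_trans (ler_normB _ _) _.
rewrite ![`|_ * bernstein_basis _ _ _|]normrM mulrDr.
rewrite (ger0_norm (B i)) (ger0_norm (B i.+1)).
by rewrite lerD// ler_wpM2r// inner// ler_norml; apply/andP; split; lra.
Qed.

Lemma lambda_bernstein_basis_sum_dist (R : realType) (lambda : R) (n : nat)
    (x : R) :
  -1 <= lambda <= 1 -> (2 <= n)%N -> 0 <= x <= 1 ->
  \sum_(i < n.+1)
    `|lambda_bernstein_basis lambda n i x - bernstein_basis n i x| <=
  2 / (n%:R + 1).
Proof.
move=> lam1 n2 x01.
have B k := bernstein_basis_ge0 n.+1 k x01.
apply: (@le_trans _ _ (\sum_(i < n.+1) (n%:R + 1)^-1 *
    (bernstein_basis n.+1 i x + bernstein_basis n.+1 i.+1 x))).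
  by apply: ler_sum => i _; rewrite lambda_bernstein_basis_dist// -ltnS.
rewrite -mulr_sumr mulrC ler_wpM2r ?invr_ge0 ?addr_ge0// big_split/=.
have s1 := bernstein_sum1 n.+1 x.
(* The indices 0..n and 1..n+1 each miss one nonnegative term of the degree n + 1 partition of
   unity. *)
apply: lerD; rewrite -[leRHS]s1.
  by rewrite [leRHS]big_ord_recr/= lerDl.
by rewrite [leRHS]big_ord_recl/= lerDr.
Qed.

(** Change one factor at a time: a'b' - ab = (a' - a) b' + a (b' - b). *)
Lemma double_sum_dist (R : realType) (I J : finType) (F : I -> J -> R)
    (a a' : I -> R) (b b' : J -> R) (M : R) :
  (forall i j, `|F i j| <= M) ->
  `|(\sum_i \sum_j F i j * a' i * b' j) - \sum_i \sum_j F i j * a i * b j| <=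
  M * ((\sum_i `|a' i - a i|) * (\sum_j `|b' j|)
       + (\sum_i `|a i|) * (\sum_j `|b' j - b j|)).
Proof.
move=> FM; rewrite -sumrB !big_distrlr/= -big_split mulr_sumr.
apply: le_trans (ler_norm_sum _ _ _) _; apply: ler_sum => i _.
rewrite -sumrB -big_split mulr_sumr.
apply: le_trans (ler_norm_sum _ _ _) _; apply: ler_sum => j _ /=.
rewrite (_ : _ - _ = F i j * ((a' i - a i) * b' j + a i * (b' j - b j)));
  last by ring.
rewrite normrM; apply: ler_pM => //.
by apply: le_trans (ler_normD _ _) _; rewrite !normrM.
Qed.

(** Heine-Cantor. In the near-covering form of compactness the radius d is the filter variable, so
    local estimates yield one d valid on all of K. *)
Lemma compact_within_unif_continuous (R : realType) (T : pseudoMetricType R)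
    (K : set T) (f : T -> R) (e : R) :
  compact K -> {within K, continuous f} -> 0 < e ->
  exists2 d : R, 0 < d &
    forall x y, K x -> K y -> ball x d y -> `|f x - f y| < e.
Proof.
move=> /compact_near_coveringP cK /subspace_continuousP cf e0.
have unif : \forall d \near (0 : R)^'+, K `<=`
    [set x | K x -> forall y, K y -> ball x d y -> `|f x - f y| < e].
  apply: cK => x Kx.
  have /cvgrPdist_lt/(_ (e / 2)) := cf x Kx.
  rewrite divr_gt0// => /(_ isT); rewrite near_withinE.
  move=> /nbhs_ballP[r/= r0 fr].
  have r20 : 0 < r / 2 by rewrite divr_gt0.
  (* Halving r keeps both z and any y within d of z inside the ball of radius r around x. *)
  exists (ball x (r / 2), [set d | 0 < d < r / 2]) =>
      [|[z d] /= [xz /andP[d0 dr]] Kz y Ky zy].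
    split => /=; first exact: nbhsx_ballx.
    by near=> d; apply/andP; split => //; near: d; exact: nbhs_right_lt.
  have fz : `|f x - f z| < e / 2.
    by apply: fr => //; apply: le_ball xz; lra.
  have fy : `|f x - f y| < e / 2.
    apply: fr => //; apply: (ball_splitr _ (le_ball (ltW dr) zy)).
    exact: ball_sym.
  have := ler_distD (f x) (f z) (f y); rewrite (distrC (f z) (f x)); lra.
have [d [d0 fd]] : exists d : R, 0 < d /\ K `<=`
    [set x | K x -> forall y, K y -> ball x d y -> `|f x - f y| < e].
  near (0 : R)^'+ => d; exists d; split => //.
  by near: d.
by exists d => // x y Kx; exact: fd.
Unshelve. all: by end_near. Qed.

(** * Error estimates for the two operators *)

Lemma node_in_unit_interval (R : realType) (n : nat) (k : 'I_n.+1) :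
  0 <= (k%:R / n%:R : R) <= 1.
Proof.
(* For [n = 0] the node is 0, since the inverse of 0 is 0. *)
rewrite divr_ge0//=; case: n k => [|n] k; first by rewrite invr0 mulr0.
by rewrite ler_pdivrMr ?ltr0n// mul1r ler_nat -ltnS.
Qed.

Lemma unit_squareE (R : realType) (p : R * R) :
  unit_square p = ((0 <= p.1 <= 1) /\ (0 <= p.2 <= 1)).
Proof. by rewrite /unit_square /= !in_itv. Qed.

Lemma bernstein_op_dist (R : realType) (n m : nat) (f : R * R -> R)
    (p : R * R) (e C : R) :
  (0 < n)%N -> (0 < m)%N -> 0 <= C -> unit_square p ->
  (forall q, unit_square q ->
    `|f q - f p| <= e + C * ((q.1 - p.1) ^+ 2 + (q.2 - p.2) ^+ 2)) ->
  `|\sum_(i < n.+1) \sum_(j < m.+1) f (i%:R / n%:R, j%:R / m%:R)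
      * bernstein_basis n i p.1 * bernstein_basis m j p.2 - f p| <=
  e + C * (n%:R^-1 + m%:R^-1).
Proof.
rewrite unit_squareE => n0 m0 C0 [p1 p2] fp.
set a := fun i : 'I_n.+1 => bernstein_basis n i p.1.
set b := fun j : 'I_m.+1 => bernstein_basis m j p.2.
set u := fun i : 'I_n.+1 => (i%:R / n%:R - p.1) ^+ 2.
set v := fun j : 'I_m.+1 => (j%:R / m%:R - p.2) ^+ 2.
have a1 : \sum_i a i = 1 by exact: bernstein_sum1.
have b1 : \sum_j b j = 1 by exact: bernstein_sum1.
have a0 i : 0 <= a i by exact: bernstein_basis_ge0.
have b0 j : 0 <= b j by exact: bernstein_basis_ge0.
have -> : f p = \sum_i \sum_j f p * a i * b j.
  under eq_bigr do rewrite -mulr_sumr b1 mulr1.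
  by rewrite -mulr_sumr a1 mulr1.
apply: (@le_trans _ _ (\sum_i \sum_j (e + C * (u i + v j)) * (a i * b j))).
  rewrite -sumrB; apply: le_trans (ler_norm_sum _ _ _) _.
  apply: ler_sum => i _; rewrite -sumrB.
  apply: le_trans (ler_norm_sum _ _ _) _; apply: ler_sum => j _.
  have ab0 := mulr_ge0 (a0 i) (b0 j).
  rewrite -!(mulrA _ (a i) (b j)) -mulrBl normrM [X in _ * X]ger0_norm//.
  rewrite ler_wpM2r//.
  apply: (fp (_, _)); rewrite unit_squareE.
  by split; exact: node_in_unit_interval.
(* Each squared deviation depends on one coordinate, and the weights of the other sum to 1, so the
   double average splits into two one-variable variances. *)
have -> : \sum_i \sum_j (e + C * (u i + v j)) * (a i * b j) =
    e + C * (\sum_i u i * a i + \sum_j v j * b j).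
  transitivity (\sum_i ((e + C * \sum_j v j * b j) * a i + C * (u i * a i))).
    apply: eq_bigr => i _.
    transitivity (\sum_j ((e + C * u i) * a i * b j + C * a i * (v j * b j))).
      by apply: eq_bigr => j _; ring.
    by rewrite big_split/= -!mulr_sumr b1; ring.
  by rewrite big_split/= -!mulr_sumr a1; ring.
by rewrite lerD2l ler_wpM2l// lerD// bernstein_variance_le.
Qed.

Lemma lambda_bernstein_op_dist (R : realType) (lambda : R) (n m : nat)
    (f : R * R -> R) (p : R * R) (M : R) :
  -1 <= lambda <= 1 -> (2 <= n)%N -> (2 <= m)%N -> unit_square p -> 0 <= M ->
  (forall q, unit_square q -> `|f q| <= M) ->
  `|lambda_bernstein_op lambda n m f p
    - \sum_(i < n.+1) \sum_(j < m.+1) f (i%:R / n%:R, j%:R / m%:R)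
      * bernstein_basis n i p.1 * bernstein_basis m j p.2| <=
  4 * M * (n%:R^-1 + m%:R^-1).
Proof.
rewrite unit_squareE => lam1 n2 m2 [p1 p2] M0 fM.
have inv_le k : (2 <= k)%N -> (k%:R + 1)^-1 <= k%:R^-1 :> R.
  by case: k => // k _; rewrite lef_pV2 ?posrE ?ltr0n ?addr_gt0 ?ltr0n// lerDl.
have n0 : 0 <= n%:R^-1 :> R by rewrite invr_ge0.
have m0 : 0 <= m%:R^-1 :> R by rewrite invr_ge0.
have mV : m%:R^-1 <= 2^-1 :> R.
  by rewrite lef_pV2 ?posrE ?ltr0n// ?ler_nat// (leq_trans _ m2).
have da := lambda_bernstein_basis_sum_dist lam1 n2 p1.
have db := lambda_bernstein_basis_sum_dist lam1 m2 p2.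
set a := fun i : 'I_n.+1 => bernstein_basis n i p.1.
set b := fun j : 'I_m.+1 => bernstein_basis m j p.2.
set a' := fun i : 'I_n.+1 => lambda_bernstein_basis lambda n i p.1.
set b' := fun j : 'I_m.+1 => lambda_bernstein_basis lambda m j p.2.
have a1 : \sum_i `|a i| = 1.
  rewrite -(bernstein_sum1 n p.1); apply: eq_bigr => i _.
  by rewrite ger0_norm// bernstein_basis_ge0.
have b1 : \sum_j `|b j| = 1.
  rewrite -(bernstein_sum1 m p.2); apply: eq_bigr => j _.
  by rewrite ger0_norm// bernstein_basis_ge0.
have {}da : \sum_i `|a' i - a i| <= 2 * n%:R^-1.
  by apply: le_trans da _; rewrite ler_wpM2l// inv_le.
have {}db : \sum_j `|b' j - b j| <= 2 * m%:R^-1.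
  by apply: le_trans db _; rewrite ler_wpM2l// inv_le.
(* The bound is 1 + 2 / m, at most 2 because m >= 2. This factor 2 times the 2 / n of [da] produces
   the constant 4. *)
have b'2 : \sum_j `|b' j| <= 2.
  apply: (@le_trans _ _ (\sum_j (`|b' j - b j| + `|b j|))).
    by apply: ler_sum => j _; apply: le_trans (ler_normD _ _); rewrite subrK.
  by rewrite big_split/= b1; lra.
apply: le_trans (double_sum_dist (M := M) _ _ _ _ _) _ => [i j|].
  by apply: fM; rewrite unit_squareE; split; exact: node_in_unit_interval.
rewrite -/a -/a' -/b -/b' a1 mul1r [4 * M]mulrC -mulrA ler_wpM2l//.
apply: (@le_trans _ _ (2 * n%:R^-1 * 2 + 2 * m%:R^-1)); last by lra.
by rewrite lerD// ler_pM// sumr_ge0.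
Qed.

Theorem theorem4p2 (R : realType) (lambda : R) (f : R * R -> R)
  (hlambda : -1 <= lambda <= 1)
  (hf : {within @unit_square R, continuous f}) :
  {uniform @unit_square R,
    (fun nm : nat * nat => lambda_bernstein_op lambda nm.1 nm.2 f)
      @ (\oo, \oo) --> f}.
Proof.
have cK : compact (@unit_square R).
  by apply: compact_setX; exact: segment_compact.
have [M M0 fM] : exists2 M, 0 <= M & forall q, unit_square q -> `|f q| <= M.
  have /compact_bounded[M [_ fM]] := continuous_compact hf cK.
  (* Boundedness holds for every constant strictly above [M]; this one is also nonnegative. *)
  exists (`|M| + 1) => [|q Kq]; first by rewrite addr_ge0.
  apply: (fM (`|M| + 1)); first by rewrite (le_lt_trans (ler_norm _)) ?ltrDl.
  by exists q.
move=> P /uniform_nbhs[E [entE EP]].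
have [e /= e0 eE] : filter_from [set e : R | 0 < e]
    (fun e => [set xy | ball xy.1 e xy.2]) E.
  by move: entE; rewrite -entourage_ballE.
have e20 : 0 < e / 2 by rewrite divr_gt0.
have [d d0 fd] := compact_within_unif_continuous cK hf e20.
pose C := 2 * M / d ^+ 2.
have C0 : 0 <= C by rewrite divr_ge0 ?mulr_ge0 ?exprn_ge0 ?(ltW d0).
have modulus p q : unit_square p -> unit_square q ->
    `|f q - f p| <= e / 2 + C * ((q.1 - p.1) ^+ 2 + (q.2 - p.2) ^+ 2).
  move=> Kp Kq.
  have [dist|far] := pselect (ball q d p).
    apply: le_trans (ltW (fd _ _ Kq Kp dist)) _.
    by rewrite lerDl mulr_ge0// addr_ge0// sqr_ge0.
  have fMM : `|f q - f p| <= 2 * M.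
    by apply: le_trans (ler_normB _ _) _; have := fM q Kq; have := fM p Kp; lra.
  suff d2 : d ^+ 2 <= (q.1 - p.1) ^+ 2 + (q.2 - p.2) ^+ 2.
    apply: (le_trans fMM); apply: ler_wpDl; first exact: ltW.
    rewrite -mulrA ler_peMr ?mulr_ge0// mulrC ler_pdivlMr ?exprn_gt0//.
    by rewrite mul1r.
  (* The ball of a product is a box: a sum of squares below d^2 puts each coordinate within d,
     against [far]. *)
  rewrite leNgt; apply/negP => lt_d; apply: far.
  have coord (s t : R) : 0 <= t -> s ^+ 2 + t < d ^+ 2 -> `|s| < d.
    move=> t0 st; rewrite ltNge; apply/negP => ds.
    by have := real_normK (num_real s); nra.
  split => /=; first by apply: coord lt_d; exact: sqr_ge0.
  by rewrite addrC in lt_d; apply: coord lt_d; exact: sqr_ge0.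
(* The two error estimates add up to e / 2 + D (1/n + 1/m), so a threshold of e / 4 for each of D /
   n and D / m gives a total below e. *)
pose D := 4 * M + C.
pose large := [set n : nat | (2 <= n)%N /\ D * n%:R^-1 < e / 4].
have near_oo : \forall n \near \oo, large n.
  have D0 : 0 <= D by rewrite addr_ge0// mulr_ge0.
  near=> n; split; first by near: n; exact: nbhs_infty_ge.
  have nD : D / (e / 4) < n%:R by near: n; exact: nbhs_infty_gtr.
  have n0 : 0 < n%:R :> R by apply: le_lt_trans nD; rewrite !divr_ge0// ltW.
  by rewrite ltr_pdivrMr// mulrC -ltr_pdivrMr// divr_gt0.
exists (large, large) => //.
move=> [n m] /= [[n2 nD] [m2 mD]]; apply: EP => p Kp; apply: eE.
rewrite /ball/= distrC.
have := lambda_bernstein_op_dist hlambda n2 m2 Kp M0 fM.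
have := bernstein_op_dist (ltnW n2) (ltnW m2) C0 Kp (fun q => modulus p q Kp).
set S := \sum_(i < _) _.
have := ler_distD S (lambda_bernstein_op lambda n m f p) (f p).
rewrite /D in nD mD; lra.
Unshelve. all: by end_near. Qed.
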